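(* For every integer $n>2$ there is a problem instance with identical resources (all delays equal) and $n$ tasks with weights in the range $[1,n^2]$ for which $$\min_{N\in\mathcal{N}} C(N)\;\ge\;\frac{n}{5}\,\min_{A\in\mathcal{A}} C(A),$$ where $\mathcal{A}$ is the set of all assignments and $\mathcal{N}$ is the set of all Nash assignments of the instance.
   Context: A problem instance $(T,R)$ consists of a set $R=\{1,\dots,m\}$ of resources with delays (positive reals) $d_1\le\dots\le d_m$ and a set $T=\{1,\dots,n\}$ of tasks with real weights $w_1,\dots,w_n\ge 1$. An assignment is a vector $A=(A_1,\dots,A_n)\in\mathcal{A}=\{1,\dots,m\}^n$ (task $i$ is assigned to resource $A_i$). The load of resource $\ell$ in $A$ is $L(\ell,A)=d_\ell\sum_{i\in T:\,A_i=\ell}w_i$, the load of task $i$ is $L(A_i,A)$, and the social cost is $C(A)=\sum_{i\in T}L(A_i,A)$. An assignment $A$ is a Nash assignment if for every task $i$ and every resource $\ell$ we have $L(A_i,A)\le L(\ell,A')$, where $A'$ is obtained from $A$ by re-assigning task $i$ to resource $\ell$ and making no other change. $\mathcal{N}=\mathcal{N}(T,R)$ is the set of all Nash assignments; it is known to be nonempty. *)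

(* Defs.v *)
From HB Require Import structures.
From mathcomp Require Import all_boot all_order all_algebra.
From mathcomp Require Import boolp classical_sets reals.

Set Implicit Arguments.
Unset Strict Implicit.
Unset Printing Implicit Defensive.

Import Order.TTheory GRing.Theory Num.Theory.

Local Open Scope classical_set_scope.
Local Open Scope ring_scope.

(* Tasks and resources are numbered from 0: tasks are 'I_n, resources 'I_m. *)
Record instance (R : realType) (n m : nat) := Instance {
  delay : 'I_m -> R;
  weight : 'I_n -> R;
  delay_gt0 : forall l, 0 < delay l;
  delay_sorted : forall k l : 'I_m, (k <= l)%N -> delay k <= delay l;
  weight_ge1 : forall i, 1 <= weight i
}.

Definition assignment (n m : nat) := {ffun 'I_n -> 'I_m}.

Definition reassign (n m : nat) (A : assignment n m) (i : 'I_n) (l : 'I_m) :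
  assignment n m := [ffun j => if j == i then l else A j].

Section Cost.
Variables (R : realType) (n m : nat) (I : instance R n m).

Definition load (l : 'I_m) (A : assignment n m) : R :=
  delay I l * \sum_(i < n | A i == l) weight I i.

Definition social_cost (A : assignment n m) : R :=
  \sum_(i < n) load (A i) A.

Definition nash : set (assignment n m) :=
  [set A : assignment n m | forall (i : 'I_n) (l : 'I_m),
    load (A i) A <= load l (reassign A i l)].

Definition identical_resources : Prop :=
  forall k l : 'I_m, delay I k = delay I l.

End Cost.

(* v is the minimum of S; in particular S is nonempty. *)
Definition is_minimum (R : realType) (S : set R) (v : R) : Prop :=
  S v /\ lbound S v.

(* Main.v *)
(** Take two resources of delay 1, two tasks of weight [n ^ 2] and [n - 2] tasks
    of weight 1.  Putting both heavy tasks on one resource and all the light ones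
    on the other costs [4 n ^ 2 + (n - 2) ^ 2 <= 5 n ^ 2].  In a Nash assignment
    the heavy tasks are separated, since the light tasks alone weigh less than
    [n ^ 2]; hence every task has load at least [n ^ 2] and the cost is at least
    [n ^ 3]. *)
Require Import Defs.
From HB Require Import structures.
From mathcomp Require Import all_boot all_order all_algebra.
From mathcomp Require Import boolp classical_sets reals.
From mathcomp Require Import lra.

Set Implicit Arguments.
Unset Strict Implicit.
Unset Printing Implicit Defensive.

Import Order.TTheory GRing.Theory Num.Theory.

Local Open Scope classical_set_scope.
Local Open Scope ring_scope.

(** A finite type has an argument minimum over any inhabited boolean predicate; [asbool] turns the
    classical set [S] into one. The witness [x0] is why a Nash assignment must be exhibited
    below. *)
Lemma image_has_minimum (R : realType) (T : finType) (S : set T) (f : T -> R)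
    (x0 : T) :
  S x0 -> exists2 x, S x & is_minimum [set f y | y in S] (f x).
Proof.
move=> Sx0; have Px0 : `[< S x0 >] by apply/asboolP.
case: (arg_minP (P := fun x => `[< S x >]) f Px0) => x /asboolP Sx minx.
exists x => //; split; first by exists x.
by move=> _ [y Sy <-]; apply: minx; apply/asboolP.
Qed.

Section Load.
Variables (R : realType) (n m : nat) (I : instance R n m).
Implicit Types (A : assignment n m) (i : 'I_n) (l : 'I_m).

Lemma reassign_id A i : reassign A i (A i) = A.
Proof. by apply/ffunP=> j; rewrite ffunE; case: eqP => [->|]. Qed.

Lemma weight_ge0 i : 0 <= weight I i.
Proof. exact: le_trans ler01 (weight_ge1 I i). Qed.

Lemma load_reassign A i l : A i != l ->
  load I l (reassign A i l) = load I l A + delay I l * weight I i.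
Proof.
move=> Ail; rewrite /load -mulrDr; congr (_ * _).
rewrite (bigD1 i) ?ffunE ?eqxx //= addrC; congr (_ + _).
apply: eq_bigl => j; rewrite ffunE.
by have [->|_] := eqVneq j i; rewrite ?andbT // eqxx (negbTE Ail).
Qed.

Lemma weight_le_load A i : delay I (A i) * weight I i <= load I (A i) A.
Proof.
rewrite ler_pM2l ?delay_gt0 // (bigD1 i) //= lerDl.
by apply: sumr_ge0 => j _; apply: weight_ge0.
Qed.

Lemma weight2_le_load A i j : i != j -> A i = A j ->
  delay I (A i) * (weight I i + weight I j) <= load I (A i) A.
Proof.
move=> ij Aij; rewrite ler_pM2l ?delay_gt0 // (bigD1 i) //= lerD2l.
rewrite (bigD1 j) /= ?Aij ?eqxx 1?eq_sym // lerDl.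
by apply: sumr_ge0 => t _; apply: weight_ge0.
Qed.

End Load.

Section HeavyPair.
Variables (R : realType) (k : nat).
Let n := k.+2.

Definition heavy_pair_weight (i : 'I_n) : R :=
  if (i < 2)%N then n%:R ^+ 2 else 1.

Lemma heavy_pair_weight_ge1 i : 1 <= heavy_pair_weight i.
Proof.
by rewrite /heavy_pair_weight; case: ifP => // _; rewrite exprn_ege1 // ler1n.
Qed.

Definition heavy_pair : instance R n 2 :=
  @Instance R n 2 (fun=> 1) heavy_pair_weight
    (fun=> ltr01) (fun _ _ _ => lexx 1) heavy_pair_weight_ge1.

Let h0 : 'I_n := ord0.
Let h1 : 'I_n := lift ord0 ord0.

Lemma heavy_pair_load (l : 'I_2) (A : assignment n 2) :
  load heavy_pair l A =
    (A h0 == l)%:R * n%:R ^+ 2 + (A h1 == l)%:R * n%:R ^+ 2 +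
    \sum_(i < k) (A (lift ord0 (lift ord0 i)) == l)%:R.
Proof.
rewrite /load mul1r big_mkcond !big_ord_recl /= /heavy_pair_weight /= addrA.
congr (_ + _ + _); rewrite ?mulr_natl ?mulrb //.
by apply: eq_bigr => i _; case: eqP.
Qed.

(** If the heavy tasks shared a resource, its load would be at least [2 * n ^ 2], while moving [h0]
    away would give it load at most [k + n ^ 2], which is smaller since [k < n ^ 2]. *)
Lemma nash_separates_heavy (A : assignment n 2) :
  (0 < k)%N -> nash heavy_pair A -> A h0 != A h1.
Proof.
move=> k_gt0 nashA; apply/negP => /eqP Ah.
(* [l] is the other one of the two resources. *)
pose l := lift (A h0) ord0; have Al : A h0 != l by apply: neq_lift.
have := nashA h0 l; rewrite load_reassign //= mul1r /heavy_pair_weight /=.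
have := weight2_le_load heavy_pair (isT : h0 != h1) Ah.
rewrite /= mul1r /heavy_pair_weight /=.
rewrite (heavy_pair_load l) -Ah (negbTE Al) !mul0r !add0r.
have : \sum_(i < k) ((A (lift ord0 (lift ord0 i)) == l)%:R : R) <= k%:R.
  rewrite -[leRHS]mulr_natr mul1r -[in leRHS](card_ord k) -sumr_const.
  by apply: ler_sum => i _; rewrite lern1; case: (_ == _).
have : (k%:R : R) < n%:R ^+ 2.
  by rewrite -natrX ltr_nat (@leq_trans n) // -{1}(expn1 n) leq_exp2l.
lra.
Qed.

Lemma heavy_pair_nash_cost (A : assignment n 2) :
  (0 < k)%N -> nash heavy_pair A -> n%:R ^+ 3 <= social_cost heavy_pair A.
Proof.
move=> k_gt0 /(nash_separates_heavy k_gt0) sepA.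
have -> : n%:R ^+ 3 = \sum_(i < n) n%:R ^+ 2 :> R.
  by rewrite sumr_const card_ord exprS mulr_natl.
apply: ler_sum => i _ /=.
(* The separated heavy tasks occupy both resources, so task [i] shares its resource with one of
   them. *)
have [h Ah hheavy] : exists2 h, A i = A h & (h < 2)%N.
  have [Ai0|Ai0] := eqVneq (A i) (A h0); first by exists h0.
  exists h1 => //; apply/val_inj; move: sepA Ai0; rewrite -!val_eqE /=.
  by case: (A i) (A h0) (A h1) => [[|[|?]] ?] [[|[|?]] ?] [[|[|?]] ?].
have := weight_le_load heavy_pair A h.
by rewrite Ah /= mul1r /heavy_pair_weight hheavy.
Qed.

Definition heavy_together : assignment n 2 :=
  [ffun i : 'I_n => if (i < 2)%N then ord0 else ord_max].

(** The two heavy tasks have load [2 * n ^ 2] each and the [k] light ones load [k] each, so the cost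
    is [4 * n ^ 2 + k ^ 2]. *)
Lemma heavy_together_cost :
  social_cost heavy_pair heavy_together <= 5%:R * n%:R ^+ 2.
Proof.
rewrite /social_cost !big_ord_recl (eq_bigr (fun=> k%:R)); last first.
  move=> i _; rewrite heavy_pair_load !ffunE /= !mul0r !add0r.
  under eq_bigr do rewrite ffunE /=.
  by rewrite sumr_const card_ord.
rewrite sumr_const card_ord !heavy_pair_load !ffunE /= !mul1r.
rewrite big1 => [|i _]; last by rewrite ffunE.
have : (k%:R *+ k : R) <= n%:R ^+ 2.
  rewrite -mulr_natr -natrM -natrX ler_nat expnS expn1.
  by rewrite leq_mul // /n (leqW (leqnSn k)).
lra.
Qed.

(** A Nash assignment that witnesses that the set of Nash costs is nonempty: one heavy task on each
    resource, the light tasks dealt out in turn. *)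
Definition alternating : assignment n 2 :=
  [ffun i : 'I_n => if odd i then ord_max else ord0].

(** The heavy contributions cancel, and among the [k] light tasks those of even rank exceed those of
    odd rank by the parity of [k]. *)
Lemma alternating_load_gap :
  load heavy_pair ord0 alternating =
  load heavy_pair ord_max alternating + (odd k)%:R.
Proof.
have gap p : \sum_(i < p) ((~~ odd i)%:R : R) =
    \sum_(i < p) ((odd i)%:R : R) + (odd p)%:R.
  elim: p => [|p IHp]; first by rewrite !big_ord0 addr0.
  by rewrite !big_ord_recr /= IHp; case: (odd p) => /=; lra.
rewrite !heavy_pair_load !ffunE /= !mul1r !mul0r addr0 add0r -addrA.
congr (_ + _).
under eq_bigr => i _.
  rewrite ffunE /= negbK (_ : (_ == _) = ~~ odd i); last by case: (odd i).
  over.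
under [in RHS]eq_bigr => i _.
  rewrite ffunE /= negbK (_ : (_ == _) = odd i); last by case: (odd i).
  over.
exact: gap.
Qed.

(** The two loads differ by at most 1 and every weight is at least 1, so no move lowers the load of
    the moving task. *)
Lemma nash_alternating : nash heavy_pair alternating.
Proof.
move=> i l; have [<-|Ail] := eqVneq (alternating i) l.
  by rewrite reassign_id.
rewrite load_reassign // mul1r.
have := heavy_pair_weight_ge1 i; have := alternating_load_gap.
have : 0 <= ((odd k)%:R : R) <= 1 by case: (odd k); rewrite !(ler01, lexx).
have ord2 (j : 'I_2) : j = ord0 \/ j = ord_max.
  by case: j => [[|[|?]] ?] //; [left|right]; apply/val_inj.
by case: (ord2 (alternating i)) (ord2 l) Ail => -> [] -> //= _; lra.
Qed.

End HeavyPair.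

Theorem lemma3p2 (R : realType) (n : nat) (hn : (2 < n)%N) :
  exists (m : nat) (I : instance R n m) (minN minA : R),
    [/\ identical_resources I,
        forall i : 'I_n, 1 <= weight I i <= n%:R ^+ 2,
        is_minimum [set social_cost I N | N in nash I] minN,
        is_minimum [set social_cost I A | A in [set: assignment n m]] minA &
        minN >= n%:R / 5%:R * minA].
Proof.
case: n hn => [|[|k]] // hk; pose I := heavy_pair R k.
have [N nashN minN] :=
  image_has_minimum (social_cost I) (@nash_alternating R k).
have [A _ minA] :=
  @image_has_minimum _ _ setT (social_cost I) (heavy_together k) Logic.I.
exists 2%N, I, (social_cost I N), (social_cost I A); split=> //.
  move=> i; rewrite (weight_ge1 I i) /= /heavy_pair_weight.
  by case: ifP => // _; rewrite exprn_ege1 // ler1n.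
apply: le_trans (heavy_pair_nash_cost hk nashN).
have leA : social_cost I A <= 5%:R * k.+2%:R ^+ 2.
  apply: le_trans (heavy_together_cost R k); apply: minA.2.
  by exists (heavy_together k).
(* Cancelling the factor [n] from [n / 5 * minA <= n ^ 3] leaves the bound [leA]. *)
by rewrite exprS -mulrA ler_pM2l ?ltr0n // ler_pdivrMl ?ltr0n.
Qed.
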